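(* The following are equivalent for any graph $G$: (1) $G$ satisfies the maximality principle $\Diamond\Box\varphi\to\varphi$ for all sentences $\varphi$ in the modal language of graph theory $\Diamond\mathcal{L}_\sim$. (2) $G$ satisfies the maximality principle $\Diamond\Box\varphi\to\varphi$ for all sentences $\varphi$ in the language of graph theory $\mathcal{L}_\sim$. (3) $G$ satisfies the maximality principle $\Diamond\Box\varphi\to\varphi$ for all existential sentences $\varphi=\exists x_0,\ldots,x_n\ \varphi_0(x_0,\ldots,x_n)$, with $\varphi_0$ quantifier free in the language of graph theory $\mathcal{L}_\sim$. (4) $G$ is universal for finite graphs.
   Context: A graph is a set of vertices (of any cardinality) together with an irreflexive symmetric binary edge relation $\sim$. $\mathcal{L}_\sim$ is the first-order language (with equality) whose only non-logical symbol is $\sim$. $\Diamond\mathcal{L}_\sim$ is the closure of the set of $\mathcal{L}_\sim$-formulas under the modal operators $\Diamond,\Box$ and Boolean connectives, but not quantifiers (so no modal operator occurs in the scope of a quantifier). Formulas are evaluated at graphs, within the class of all graphs under the substructure relation: $G\models\Diamond\varphi[\bar a]$ iff there is a graph $H$ containing $G$ as a substructure (i.e. $G$ is an induced subgraph of $H$) with $H\models\varphi[\bar a]$; $G\models\Box\varphi[\bar a]$ iff $H\models\varphi[\bar a]$ for every graph $H$ containing $G$ as a substructure; Boolean connectives and first-order formulas are interpreted as usual. A graph $G$ is universal for finite graphs if every finite graph is isomorphic to a substructure (induced subgraph) of $G$. *)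

(* Defs.v *)
From mathcomp Require Export all_boot.
From mathcomp Require Export classical_sets functions cardinality.

Set Implicit Arguments.
Unset Strict Implicit.
Unset Printing Implicit Defensive.

Local Open Scope classical_set_scope.

(* The vertex type is arbitrary: it may be infinite of any cardinality, or
   empty. *)
Record graph := Graph {
  vertex :> Type;
  adj : vertex -> vertex -> Prop;
  adj_irrefl : forall x, ~ adj x x;
  adj_sym : forall x y, adj x y -> adj y x }.

(* Substructure inclusions, up to renaming of vertices: [f] identifies [G] with
   the induced subgraph of [H] on the image of [f]. *)
Definition embedding (G H : graph) (f : G -> H) : Prop :=
  injective f /\ forall x y, adj (f x) (f y) <-> adj x y.

Definition isomorphic (G H : graph) : Prop :=
  exists f : G -> H,
    bijective f /\ forall x y, adj (f x) (f y) <-> adj x y.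

Definition induced (G : graph) (A : set G) : graph :=
  @Graph A (fun x y => adj (\val x) (\val y))
    (fun x => @adj_irrefl G (\val x))
    (fun x y => @adj_sym G (\val x) (\val y)).

Definition finite_graph (F : graph) : Prop := finite_set [set: F].

Definition universal_for_finite_graphs (G : graph) : Prop :=
  forall F : graph, finite_graph F ->
    exists A : set G, isomorphic F (induced A).

(* First-order formulas with free variables among n, in well-scoped de Bruijn
   style: in the body of a quantifier, variable [ord0] is the bound variable and
   variable [lift ord0 i] is the variable [i] of the context. *)
Inductive formula : nat -> Type :=
| Bot n : formula n
| Eq n (i j : 'I_n) : formula n
| Adj n (i j : 'I_n) : formula n
| Not n (f : formula n) : formula n
| And n (f g : formula n) : formula n
| Or n (f g : formula n) : formula n
| Imp n (f g : formula n) : formula n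
| All n (f : formula n.+1) : formula n
| Ex n (f : formula n.+1) : formula n.

Definition assign_cons (T : Type) n (x : T) (a : 'I_n -> T) : 'I_n.+1 -> T :=
  fun i => if unlift ord0 i is Some j then a j else x.

Fixpoint sat (G : graph) n (f : formula n) : ('I_n -> G) -> Prop :=
  match f in formula n return ('I_n -> G) -> Prop with
  | Bot _ => fun _ => False
  | Eq _ i j => fun a => a i = a j
  | Adj _ i j => fun a => adj (a i) (a j)
  | Not _ f => fun a => ~ sat f a
  | And _ f g => fun a => sat f a /\ sat g a
  | Or _ f g => fun a => sat f a \/ sat g a
  | Imp _ f g => fun a => sat f a -> sat g a
  | All _ f => fun a => forall x : G, sat f (assign_cons x a)
  | Ex _ f => fun a => exists x : G, sat f (assign_cons x a)
  end.

Fixpoint quantifier_free n (f : formula n) : bool :=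
  match f with
  | Bot _ | Eq _ _ _ | Adj _ _ _ => true
  | Not _ f => quantifier_free f
  | And _ f g | Or _ f g | Imp _ f g => quantifier_free f && quantifier_free g
  | All _ _ | Ex _ _ => false
  end.

Fixpoint ex_closure n : formula n -> formula 0 :=
  match n return formula n -> formula 0 with
  | 0 => fun f => f
  | m.+1 => fun f => ex_closure (Ex f)
  end.

Inductive modal_formula (n : nat) : Type :=
| FO (f : formula n)
| MNot (p : modal_formula n)
| MAnd (p q : modal_formula n)
| MOr (p q : modal_formula n)
| MImp (p q : modal_formula n)
| Dia (p : modal_formula n)
| Box (p : modal_formula n).

Fixpoint msat n (p : modal_formula n) (G : graph) (a : 'I_n -> G) : Prop :=
  match p with
  | FO f => sat f a
  | MNot p => ~ msat p a
  | MAnd p q => msat p a /\ msat q a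
  | MOr p q => msat p a \/ msat q a
  | MImp p q => msat p a -> msat q a
  | Dia p => exists (H : graph) (e : G -> H), embedding e /\ msat p (e \o a)
  | Box p => forall (H : graph) (e : G -> H), embedding e -> msat p (e \o a)
  end.

Definition sentence : Type := formula 0.
Definition modal_sentence : Type := modal_formula 0.

Definition empty_assign (T : Type) : 'I_0 -> T :=
  fun i => False_rect T (notF (ltn_ord i)).

Definition holds (G : graph) (p : modal_sentence) : Prop :=
  msat p (@empty_assign G).

Definition maximality_principle (p : modal_sentence) : modal_sentence :=
  MImp (Dia (Box p)) p.

(* Main.v *)
(* If G is universal for finite graphs, then by compactness (an ultrapower of G)
   every graph H embeds in some K elementarily equivalent to G. A first-order
   sentence possibly necessary at G, say necessary at an extension H of G, is
   therefore true in K, hence in G. For modal sentences one shows that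
   elementarily equivalent universal graphs satisfy the same modal sentences:
   extensions of a universal graph are universal, so any extension of one graph
   is matched, up to elementary equivalence, by an extension of the other.
   Conversely, the diagram of a finite graph F is an existential sentence that
   becomes permanently true after adding a disjoint copy of F to G. *)
From mathcomp Require Import boolp filter.
Require Import Defs.

Set Implicit Arguments.
Unset Strict Implicit.
Unset Printing Implicit Defensive.

Local Open Scope classical_set_scope.

(** * Embeddings and universality for finite graphs *)

Lemma embedding_comp (G H K : graph) (f : G -> H) (g : H -> K) :
  embedding f -> embedding g -> embedding (g \o f).
Proof.
move=> [fI fA] [gI gA]; split; first exact: inj_comp.
by move=> x y; apply: iff_trans (fA x y); exact: gA.
Qed.

(** The range of an embedding serves as [A]. Embeddings compose directly, so later arguments work
    with this form of universality. *)
Lemma universalP (G : graph) : universal_for_finite_graphs G <->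
  forall F : graph, finite_graph F -> exists f : F -> G, embedding f.
Proof.
split=> univG F /univG.
  move=> [A [f [/bij_inj fI fA]]]; exists (fun x => \val (f x)).
  by split; [exact: inj_comp val_inj fI | exact: fA].
move=> [f [fI fA]]; exists (range f).
have fR x : f x \in range f by apply/mem_set; exists x.
exists (fun x => SigSub (fR x)); split; last exact: fA.
have /choice[g gK] : forall y : set_type (range f), exists x, f x = \val y.
  by move=> [y yR]; have [x _ xy] := set_mem yR; exists x.
exists g => [x|y]; last by apply: val_inj; rewrite /= gK.
by apply: fI; rewrite gK.
Qed.

Lemma universal_embedding (G H : graph) (e : G -> H) : embedding e ->
  universal_for_finite_graphs G -> universal_for_finite_graphs H.
Proof.
move=> eE /universalP univG; apply/universalP => F /univG[f fE].
by exists (e \o f); exact: embedding_comp.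
Qed.

(** The map is total on [H] although controlled only on [A]: the maps for different [A] then share
    one type and can serve as coordinates of an ultrapower. *)
Lemma universal_finite_subset (G H : graph) (A : set H) :
  universal_for_finite_graphs G -> finite_set A ->
  exists f : H -> G, {in A &, injective f} /\
    {in A &, forall x y, adj (f x) (f y) <-> adj x y}.
Proof.
move=> /universalP univG finA.
have [g0 _] : exists g0 : G, True.
  (* Universality for the one-vertex graph yields a default vertex [g0] for arguments outside
     [A]. *)
  pose P := @Graph unit (fun _ _ => False) (fun _ => id) (fun _ _ => id).
  by have [f _] := univG P (@finite_finset _ _); exists (f tt).
have [|f [fI fA]] := univG (induced A).
  by have [n An] := finA; exists n; rewrite (card_eql (card_setT A)).
have /choice[h hE] : forall x, exists y, forall xA : x \in A,
    y = f (exist _ x xA).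
  move=> x; have [xA|] := pselect (x \in A); last by exists g0.
  by exists (f (exist _ x xA)) => xA'; congr f; exact: val_inj.
exists h; split=> x y xA yA.
  by rewrite (hE x xA) (hE y yA) => /fI[].
by rewrite (hE x xA) (hE y yA); exact: fA.
Qed.

(** * Ultrapowers of a graph and the theorem of Los *)

Section Ultraproduct.
Variables (I : Type) (U : set_system I) (UU : UltraFilter U) (G : graph).

Lemma ultra_not (A : set I) : U (~` A) <-> ~ U A.
Proof.
split=> [nA A_|]; last by have [] := in_ultra_setVsetC A UU.
have : U (A `&` ~` A) by exact: filterI.
by rewrite setICr; exact: filter_not_empty.
Qed.

Lemma ultra_and (A B : set I) : U (A `&` B) <-> U A /\ U B.
Proof.
split=> [AB|[]]; last exact: filterI.
by split; apply: filterS AB => i [].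
Qed.

(** The class of [f] modulo [U], kept as a set of functions so that equality in the ultrapower is
    plain equality of sets. *)
Definition eq_near (f : I -> G) : set (I -> G) :=
  [set g | U [set i | f i = g i]].

Lemma eq_near_refl f : eq_near f f.
Proof. by apply: filterS filterT. Qed.

Lemma eq_near_eq f g : eq_near f = eq_near g <-> eq_near f g.
Proof.
split=> [->|fg]; first exact: eq_near_refl.
apply/seteqP; split=> h; rewrite /eq_near /=.
  by move: fg; apply: filterS2 => i /= -> ->.
by move: fg; apply: filterS2 => i /= -> ->.
Qed.

Definition ultrapower_vertex : Type := set_type (range eq_near).

Definition ultrapower_adj (x y : ultrapower_vertex) : Prop :=
  exists f g, [/\ \val x f, \val y g & U [set i | adj (f i) (g i)]].

Lemma cls_subproof f : eq_near f \in range eq_near.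
Proof. by apply/mem_set; exists f. Qed.

Definition cls f : ultrapower_vertex := SigSub (cls_subproof f).

Lemma cls_surj x : exists f, cls f = x.
Proof.
by case: x => x xR; have [f _ fx] := set_mem xR; exists f; exact: val_inj.
Qed.

Lemma cls_eq f g : cls f = cls g <-> U [set i | f i = g i].
Proof.
apply: iff_trans (eq_near_eq f g); split=> [[]//|fg].
exact: val_inj.
Qed.

Lemma ultrapower_adjE f g :
  ultrapower_adj (cls f) (cls g) <-> U [set i | adj (f i) (g i)].
Proof.
split=> [[f' [g' [/= ff' gg' adjf'g']]]|adjfg]; last first.
  by exists f, g; split=> //; exact: eq_near_refl.
by move: ff' gg' adjf'g'; rewrite /eq_near /=; apply: filterS3 => i /= -> ->.
Qed.

Lemma ultrapower_adj_irrefl x : ~ ultrapower_adj x x.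
Proof.
have [f <-] := cls_surj x; move=> /ultrapower_adjE.
by move=> /filter_ex[i /= /adj_irrefl].
Qed.

Lemma ultrapower_adj_sym x y : ultrapower_adj x y -> ultrapower_adj y x.
Proof.
move=> [f [g [xf yg fg]]]; exists g, f; split=> //.
by apply: filterS fg => i /=; exact: adj_sym.
Qed.

Definition ultrapower : graph :=
  Graph ultrapower_adj_irrefl ultrapower_adj_sym.

(** Witnesses are chosen coordinatewise, with a default at the coordinates that have none. This
    handles the quantifiers in [los]. *)
Lemma ultra_choice (P : I -> G -> Prop) :
  U [set i | exists x, P i x] -> exists g, U [set i | P i (g i)].
Proof.
move=> exP; have [i0 [x0 _]] := filter_ex exP.
have /choice[g gP] : forall i, exists y, (exists x, P i x) -> P i y.
  move=> i; have [[x Px]|nP] := pselect (exists x, P i x); last by exists x0.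
  by exists x.
by exists g; apply: filterS exP => i; exact: gP.
Qed.

Lemma assign_cons_comp (T V : Type) (h : T -> V) n (x : T) (a : 'I_n -> T) :
  assign_cons (h x) (h \o a) = h \o assign_cons x a.
Proof. by apply/funext => i; rewrite /assign_cons /=; case: unlift. Qed.

(** Los's theorem, by induction on [f]. Maximality of [U] decides the propositional connectives, and
    witness functions settle the quantifiers. *)
Lemma los n (f : formula n) (a : 'I_n -> I -> G) :
  sat (G := ultrapower) f (cls \o a) <->
  U [set i | sat f (fun v => a v i)].
Proof.
have consE m (g : I -> G) (b : 'I_m -> I -> G) i :
    (fun v => assign_cons g b v i) = assign_cons (g i) (fun v => b v i).
  by apply/funext => v; rewrite /assign_cons; case: unlift.
elim: f a => {n} /= [n|n i j|n i j|n f IH|n f IHf g IHg|n f IHf g IHg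
                    |n f IHf g IHg|n f IH|n f IH] a.
- by split=> // /filter_ex[].
- exact: cls_eq.
- exact: ultrapower_adjE.
- by apply: iff_trans (iff_sym (ultra_not _)); rewrite (propext (IH a)).
- by rewrite (propext (IHf a)) (propext (IHg a)); exact: iff_sym (ultra_and _ _).
- rewrite (propext (IHf a)) (propext (IHg a)); split.
    by move=> [|]; apply: filterS => i; [left|right].
  have [Uf|/ultra_not Unf Ufg] := pselect (U [set i | sat f (a^~ i)]).
    by left.
  by right; move: Unf Ufg; apply: filterS2 => i /= nf [/nf|].
- rewrite (propext (IHf a)) (propext (IHg a)); split=> [fg|Ufg]; last first.
    by move: Ufg; apply: filterS2 => i /=; apply.
  have [/fg|/ultra_not] := pselect (U [set i | sat f (a^~ i)]).
    by apply: filterS => i /= sg _.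
  by apply: filterS => i /= nf /nf.
- split=> [allf|allf x]; last first.
    have [g <-] := cls_surj x; rewrite assign_cons_comp; apply/IH.
    by apply: filterS allf => i /=; rewrite consE; exact.
  (* Otherwise counterexamples exist at almost every coordinate, and together they form a class
     [cls g] that refutes [allf]. *)
  apply: contrapT => /ultra_not nallf.
  have [|g ng] := @ultra_choice (fun i x => ~ sat f (assign_cons x (a^~ i))).
    by apply: filterS nallf => i /existsNP.
  have := allf (cls g); rewrite assign_cons_comp => /IH.
  apply: (proj1 (ultra_not _)); apply: filterS ng => i /=.
  by rewrite consE.
- split=> [[x]|/ultra_choice[g gf]]; last first.
    exists (cls g); rewrite assign_cons_comp; apply/IH.
    by apply: filterS gf => i /=; rewrite consE.
  have [g <-] := cls_surj x; rewrite assign_cons_comp => /IH.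
  by apply: filterS => i /=; rewrite consE; exists (g i).
Qed.

End Ultraproduct.

(** * Elementary equivalence and extension by ultrapowers *)

Lemma empty_assign_eq (T : Type) (a : 'I_0 -> T) : a = @empty_assign T.
Proof. by apply/funext => -[]. Qed.

Definition elementarily_equivalent (G H : graph) : Prop :=
  forall f : sentence, holds G (FO f) <-> holds H (FO f).

Lemma ultrapower_equiv (I : Type) (U : set_system I) (UU : UltraFilter U)
  (G : graph) : elementarily_equivalent (ultrapower UU G) G.
Proof.
move=> f; rewrite /holds /=.
have -> : @empty_assign (ultrapower UU G) =
    @cls I U G \o @empty_assign (I -> G) by apply/esym/empty_assign_eq.
apply: iff_trans (los _ _ _) _.
have -> : [set i | sat f (fun v => @empty_assign (I -> G) v i)] =
    [set i | sat f (@empty_assign G)].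
  by apply/funext => i /=; rewrite (empty_assign_eq (fun v => _)).
split=> [/filter_ex[]//|fG]; exact: filterS filterT.
Qed.

(* Compactness for Th(G) together with the diagram of H. *)
Lemma universal_equiv_extension (G H : graph) :
  universal_for_finite_graphs G ->
  exists K : graph, elementarily_equivalent K G /\
    exists e : H -> K, embedding e.
Proof.
move=> univG.
have /choice[e eP] : forall A : set H, exists f : H -> G, finite_set A ->
    {in A &, injective f} /\
    {in A &, forall x y, adj (f x) (f y) <-> adj x y}.
  move=> A; have [finA|] := pselect (finite_set A).
    by have [f fP] := universal_finite_subset univG finA; exists f.
  (* For infinite [A] any map will do; the case of the empty set supplies one. *)
  have [f _] := universal_finite_subset univG (@finite_set0 H).
  by exists f.
(* The filter of tails of the finite subsets of [H] ordered by inclusion. An ultrafilter above it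
   contains, for any [x] and [y], the family of finite sets holding both. *)
pose F : set_system (set H) :=
  filter_from finite_set (fun A => [set B | finite_set B /\ A `<=` B]).
have FF : ProperFilter F.
  apply: filter_from_proper; last by move=> A finA; exists A; split.
  apply: filter_from_filter; first by exists set0.
  move=> A B finA finB; exists (A `|` B); first by rewrite finite_setU.
  by move=> C [finC]; rewrite subUset => -[AC BC].
have [U [UU FU]] := ultraFilterLemma FF.
exists (ultrapower UU G); split; first exact: ultrapower_equiv.
(* A vertex [x] goes to the class of its images under the partial embeddings [e A]; almost every
   [e A] is faithful on a given pair. *)
exists (fun x => @cls _ U G (fun A => e A x)).
have nearxy x y : U [set A | [/\ finite_set A, x \in A & y \in A]].
  apply: FU; exists [set x; y] => [|A /= [finA xyA]]; first exact: finite_set2.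
  by split=> //; apply/mem_set/xyA; [left|right].
have nearE (P : set (set H)) x y : U P ->
    exists A, P A /\ [/\ finite_set A, x \in A & y \in A].
  move=> UP; suff : U (P `&` [set A | [/\ finite_set A, x \in A & y \in A]]).
    by move/filter_ex.
  exact: filterI.
split=> [x y /cls_eq exy|x y].
  have [A [eA [finA xA yA]]] := nearE _ x y exy.
  by have [eI _] := eP A finA; exact: eI eA.
split=> [/ultrapower_adjE exy|xy]; last first.
  apply/ultrapower_adjE; apply: filterS (nearxy x y) => A [finA xA yA].
  by have [_ eA] := eP A finA; exact: (proj2 (eA x y xA yA)).
have [A [eA' [finA xA yA]]] := nearE _ x y exy.
by have [_ eA] := eP A finA; exact: (proj1 (eA x y xA yA)) eA'.
Qed.

(** * Transfer of modal sentences between universal graphs *)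

Lemma universal_equiv_back_forth (G H K : graph) (e : G -> K) :
  universal_for_finite_graphs G -> universal_for_finite_graphs H ->
  embedding e ->
  exists (L : graph) (d : H -> L), [/\ embedding d,
    universal_for_finite_graphs K, universal_for_finite_graphs L &
    elementarily_equivalent K L].
Proof.
move=> univG univH eE.
have univK := universal_embedding eE univG.
(* Compactness is applied over [K], itself universal, so the extension [L] of [H] agrees with [K]
   rather than with [G]. *)
have [L [LK [d dE]]] := universal_equiv_extension H univK.
exists L, d; split=> //; first exact: (universal_embedding dE univH).
by move=> f; split=> /LK.
Qed.

(* Every subformula of a modal sentence is again a sentence, so the induction
   never has to track parameters through the embeddings. *)
Lemma equiv_universal_modal (p : modal_sentence) (G H : graph) :
  universal_for_finite_graphs G -> universal_for_finite_graphs H ->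
  elementarily_equivalent G H -> holds G p <-> holds H p.
Proof.
rewrite /holds.
elim: p G H => [f|p IH|p IHp q IHq|p IHp q IHq|p IHp q IHq|p IH|p IH] G H
  univG univH GH /=; first exact: GH;
  try by have := (IHp _ _ univG univH GH, IHq _ _ univG univH GH); tauto.
- by have := IH _ _ univG univH GH; tauto.
- have dia G' H' : universal_for_finite_graphs G' ->
      universal_for_finite_graphs H' ->
      msat (Dia p) (@empty_assign G') -> msat (Dia p) (@empty_assign H').
    move=> univG' univH' [K [e [eE pK]]].
    have [L [d [dE univK univL KL]]] :=
      universal_equiv_back_forth univG' univH' eE.
    exists L, d; split=> //; move: pK.
    rewrite (empty_assign_eq (e \o _)) (empty_assign_eq (d \o _)).
    by move/(IH _ _ univK univL KL).
  by split; exact: dia.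
- have box G' H' : universal_for_finite_graphs G' ->
      universal_for_finite_graphs H' ->
      msat (Box p) (@empty_assign G') -> msat (Box p) (@empty_assign H').
    move=> univG' univH' boxp K e eE.
    (* The matching runs backwards here: an extension [K] of [H'] is matched by an extension [L] of
       [G'], where [boxp] applies. *)
    have [L [d [dE univK univL KL]]] :=
      universal_equiv_back_forth univH' univG' eE.
    have := boxp L d dE.
    rewrite (empty_assign_eq (e \o _)) (empty_assign_eq (d \o _)).
    by move/(IH _ _ univK univL KL).
  by split; exact: box.
Qed.

(** The graph [H] where [p] is necessary extends to some [K] elementarily equivalent to [G]. So [p]
    holds in [K], which is universal, and transfers back to [G]. *)
Lemma universal_maximality (G : graph) (p : modal_sentence) :
  universal_for_finite_graphs G -> holds G (maximality_principle p).
Proof.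
move=> univG [H [e [eE boxp]]].
have [K [KG [e' e'E]]] := universal_equiv_extension H univG.
have univK : universal_for_finite_graphs K.
  exact: universal_embedding (embedding_comp eE e'E) univG.
apply/(equiv_universal_modal p univK univG KG).
by have := boxp K e' e'E; rewrite (empty_assign_eq (e' \o _)).
Qed.

(** * Existential closures and diagrams of finite graphs *)

Lemma sat_ex_closure (G : graph) n (f : formula n) (a0 : 'I_0 -> G) :
  sat (ex_closure f) a0 <-> exists a : 'I_n -> G, sat f a.
Proof.
elim: n f => [|n IH] f /=.
  split=> [fa|[a]]; first by exists a0.
  by rewrite (empty_assign_eq a) (empty_assign_eq a0).
apply: iff_trans (IH _) _; split=> [[a [x fx]]|[a fa]].
  by exists (assign_cons x a).
exists (a \o lift ord0), (a ord0); congr (sat f _): fa.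
apply/funext => i; rewrite /assign_cons.
by case: unliftP => [j ->|->].
Qed.

Definition conj_all n (I : Type) (s : seq I) (F : I -> formula n) : formula n :=
  foldr (fun x f => And (F x) f) (Not (Bot n)) s.

Lemma sat_conj_all (G : graph) n (I : eqType) (s : seq I) (F : I -> formula n)
    (a : 'I_n -> G) :
  sat (conj_all s F) a <-> forall x, x \in s -> sat (F x) a.
Proof.
elim: s => [|x s IH] /=; first by split=> // _ [].
rewrite (propext IH); split=> [[Fx Fs] y|Fs].
  by rewrite inE => /predU1P[->|/Fs].
split; first by apply: Fs; rewrite mem_head.
by move=> y ys; apply: Fs; rewrite inE ys orbT.
Qed.

Lemma quantifier_free_conj_all n (I : Type) (s : seq I) (F : I -> formula n) :
  (forall x, quantifier_free (F x)) -> quantifier_free (conj_all s F).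
Proof. by move=> Fqf; elim: s => //= x s ->; rewrite Fqf. Qed.

Definition literal n (b : bool) (f : formula n) : formula n :=
  if b then f else Not f.

(** The equality literals are what forces a realization to be injective on the vertices listed by
    [v]. *)
Definition diagram (F : graph) n (v : 'I_n -> F) : formula n :=
  conj_all (enum {: 'I_n * 'I_n}) (fun ij =>
    And (literal `[< v ij.1 = v ij.2 >] (Eq ij.1 ij.2))
        (literal `[< adj (v ij.1) (v ij.2) >] (Adj ij.1 ij.2))).

Lemma quantifier_free_diagram (F : graph) n (v : 'I_n -> F) :
  quantifier_free (diagram v).
Proof.
by apply: quantifier_free_conj_all => ij /=; case: asboolP; case: asboolP.
Qed.

Lemma sat_diagram (F G : graph) n (v : 'I_n -> F) (a : 'I_n -> G) :
  sat (diagram v) a <-> forall i j,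
    (a i = a j <-> v i = v j) /\ (adj (a i) (a j) <-> adj (v i) (v j)).
Proof.
have lit (P : Prop) (f : formula n) :
    sat (literal `[< P >] f) a <-> (sat f a <-> P).
  by rewrite /literal; case: asboolP => /= ?; tauto.
apply: iff_trans (sat_conj_all _ _ _) _; split=> [av i j|av [i j] _ /=].
  by have [|/lit ? /lit ?] := av (i, j); first exact: mem_enum.
by split; apply/lit; have [] := av i j.
Qed.

(** * Disjoint unions, and universality from the existential principle *)

Section DisjointUnion.
Variables G F : graph.

Definition disjoint_adj (x y : G + F) : Prop :=
  match x, y with
  | inl x, inl y | inr x, inr y => adj x y
  | _, _ => False
  end.

Lemma disjoint_adj_irrefl x : ~ disjoint_adj x x.
Proof. by case: x => x; exact: adj_irrefl. Qed.

Lemma disjoint_adj_sym x y : disjoint_adj x y -> disjoint_adj y x.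
Proof. by case: x y => x [] y //=; exact: adj_sym. Qed.

Definition disjoint_union : graph :=
  Graph disjoint_adj_irrefl disjoint_adj_sym.

End DisjointUnion.

Lemma existential_maximality_universal (G : graph) :
  (forall (n : nat) (f : formula n.+1), quantifier_free f ->
     holds G (maximality_principle (FO (ex_closure f)))) ->
  universal_for_finite_graphs G.
Proof.
move=> maxG; apply/universalP => F [n /card_esym/card_eqP[v]].
(* [w] lists the vertices of [F], and [r] assigns to each vertex an index in that list. *)
pose w (i : 'I_n) := \val (v (ordII i)).
have /choice[r rK] : forall x, exists i, w i = x.
  move=> x; have [|k _ vk] := @surj _ _ _ _ v (SigSub (mem_setT x)); first by [].
  by exists (IIord k); rewrite /w IIordK vk.
(* The empty graph is treated apart, since the hypothesis concerns closures with at least one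
   quantifier. *)
case: n v w r rK => [|n] v w r rK.
  have noF (x : F) : False by have := ltn_ord (r x).
  by exists (fun x => False_rect G (noF x)); split=> x; case: (noF x).
have [a /sat_diagram aw] : exists a : 'I_n.+1 -> G, sat (diagram w) a.
  apply/sat_ex_closure/(maxG _ _ (quantifier_free_diagram w)).
  (* The copy of [F] beside [G] remains induced in every further extension, so the closed diagram is
     necessary there. *)
  exists (disjoint_union G F), inl; split; first by split=> // x y [].
  move=> H d [dI dA]; apply/(sat_ex_closure (diagram w)); exists (d \o inr \o w).
  apply/sat_diagram => i j; split; last exact: dA.
  by split=> /= [/dI[]|->].
exists (a \o r); split=> [x y /=|x y /=].
  by have [-> _] := aw (r x) (r y); rewrite !rK.
by have [_] := aw (r x) (r y); rewrite !rK.
Qed.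

Theorem theorem41 (G : graph) :
  [<-> forall p : modal_sentence, holds G (maximality_principle p);
       forall f : sentence, holds G (maximality_principle (FO f));
       forall (n : nat) (f : formula n.+1), quantifier_free f ->
         holds G (maximality_principle (FO (ex_closure f)));
       universal_for_finite_graphs G].
Proof.
tfae.
- by move=> maxG f; exact: maxG.
- by move=> maxG n f _; exact: maxG.
- exact: existential_maximality_universal.
- by move=> univG p; exact: universal_maximality.
Qed.
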